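(* For each $k\in\mathbb{N}$, the sequence $(r^0_{k,n})_{n=1}^\infty$, where $r^0_{k,n}$ is the number of maximal $k$-Schreier sets $F$ with $\max F=n$, satisfies the linear recurrence with characteristic polynomial $p_k(x)$.
   Context: $\mathbb{N}$ denotes the set of positive integers. A set $F\subseteq\mathbb{N}$ is a Schreier set if it is non-empty and $|F|\leq\min F$; it is a maximal Schreier set if it is non-empty and $|F|=\min F$. For $k\in\mathbb{N}$, a set $F\subseteq \mathbb{N}$ is a maximal $k$-Schreier set if $F=E_1\cup\dots\cup E_k$ with $E_1,\dots,E_k$ maximal Schreier sets that are successive, i.e. $\max E_i<\min E_{i+1}$ for $1\leq i<k$. A sequence $(a_n)_{n=1}^\infty$ satisfies the linear recurrence with characteristic polynomial $p(x)=c_mx^m+c_{m-1}x^{m-1}+\dots+c_1x+c_0$ (with $c_m\neq 0$) if $c_ma_{n+m}+c_{m-1}a_{n+m-1}+\dots+c_1a_{n+1}+c_0a_n=0$ for every $n\in\mathbb{N}$. The polynomials $p_k$ are defined by $p_0(x)=x-1$ and $p_{k+1}(x)=p_k(x(x-1))$ for every integer $k\geq 0$; $p_k$ has degree $2^k$. *)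

(* Defs.v *)
From mathcomp Require Import all_boot all_order all_algebra finmap boolp.

Set Implicit Arguments.
Unset Strict Implicit.
Unset Printing Implicit Defensive.

Import GRing.Theory.
Local Open Scope ring_scope.
Local Open Scope fset_scope.

(* Total extremum functions: both return 0 on the empty set, and only their
   values on non-empty sets are meaningful. *)
Definition fset_max (F : {fset nat}) : nat := (\max_(x <- F) x)%N.

Definition fset_min (F : {fset nat}) : nat :=
  \big[minn/fset_max F]_(x <- F) x.

(* Subsets of the positive integers are represented in {fset nat}; 0 \notin F
   is automatic here, since fset_min F = #|` F| > 0. *)
Definition maximal_schreier (F : {fset nat}) : Prop :=
  F != fset0 /\ #|` F| = fset_min F.

Definition maximal_kschreier (k : nat) (F : {fset nat}) : Prop :=
  exists E : 'I_k -> {fset nat},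
    [/\ forall i : 'I_k, maximal_schreier (E i),
        forall i j : 'I_k, j = i.+1 :> nat ->
          (fset_max (E i) < fset_min (E j))%N
      & F = \big[fsetU/fset0]_(i < k) E i].

(* Every F with maximum n lies in the finite search space used here; see
   in_r0_sets for the resulting characterization. *)
Definition r0_sets (k n : nat) : {fset {fset nat}} :=
  [fset F in fpowerset [fset x in iota 0 n.+1]
     | `[< maximal_kschreier k F >] && (fset_max F == n)].

Definition r0 (k n : nat) : nat := #|` r0_sets k n|.

Lemma in_r0_sets (k n : nat) (F : {fset nat}) :
  F \in r0_sets k n <-> maximal_kschreier k F /\ fset_max F = n.
Proof.
rewrite /r0_sets !inE; split.
  by case/and3P => _ /asboolP hF /eqP.
case=> hF hn; apply/and3P; split; [|exact/asboolP|exact/eqP].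
rewrite fpowersetE; apply/fsubsetP => x xF.
rewrite in_fset mem_iota /= add0n ltnS -hn /fset_max.
exact: (@leq_bigmax_seq _ _ xpredT id).
Qed.

Lemma fset_maxP (F : {fset nat}) : F != fset0 ->
  fset_max F \in F /\ forall x, x \in F -> (x <= fset_max F)%N.
Proof.
move=> F0; have ub x : x \in F -> (x <= fset_max F)%N.
  by move=> xF; exact: (@leq_bigmax_seq _ _ xpredT id).
split=> //; case/fset0Pn: F0 => x xF; rewrite /fset_max.
have: (\max_(y <- F) y)%N = 0%N \/ (\max_(y <- F) y)%N \in F.
  rewrite big_seq; elim/big_ind: _ => [|a b ha hb|y]; [by left| |by right].
  by rewrite /maxn; case: ifP.
case=> // h0; move: (ub _ xF); rewrite /fset_max h0 leqn0 => /eqP x0.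
by rewrite -x0.
Qed.

Lemma fset_minP (F : {fset nat}) : F != fset0 ->
  fset_min F \in F /\ forall x, x \in F -> (fset_min F <= x)%N.
Proof.
move=> F0; split.
  rewrite /fset_min big_seq; elim/big_ind: _ => //; first by case: (fset_maxP F0).
  by move=> a b ha hb; rewrite /minn; case: ifP.
move=> x; rewrite /fset_min -[x \in F]/(x \in (F : seq nat)).
elim: (F : seq nat) => // y s IH; rewrite big_cons inE => /orP[/eqP->|xs].
  exact: geq_minl.
exact: leq_trans (geq_minr _ _) (IH xs).
Qed.

Fixpoint p_ (k : nat) : {poly int} :=
  if k is k'.+1 then p_ k' \Po ('X * ('X - 1)) else 'X - 1.

(* Sequences are indexed from 1: the value a 0 is never used. *)
Definition satisfies_recurrence (q : {poly int}) (a : nat -> int) : Prop :=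
  q != 0 /\
  forall n : nat, (0 < n)%N -> \sum_(i < size q) q`_i * a (n + i)%N = 0.

(* Main.v *)
Require Import Defs.
From mathcomp Require Import all_boot all_order all_algebra.
From mathcomp Require Import finmap boolp zify.

(* Let c_k(n) be the number of maximal k-Schreier sets contained in [0, n), so
   that r0 k n = c_k(n + 1) - c_k(n).  The decomposition of a maximal
   (k+1)-Schreier set into its last block E and the rest G is unique; choosing
   m = min E, then G below m and m - 1 further elements of E in (m, n), gives
     c_{k+1}(n) = \sum_(1 <= m < n) c_k(m) 'C(n - m - 1, m - 1) = (T c_k)(n).
   By Pascal's rule T intertwines the shift S with S (S - 1), i.e.
   S (S - 1) T = T S, hence p_{k+1}(S) T = T p_k(S) because
   p_{k+1} = p_k \Po ('X * ('X - 1)).  Since c_0 = 1 is killed by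
   p_0(S) = S - 1, each c_k is killed by p_k(S), and so is (S - 1) c_k. *)

Set Implicit Arguments.
Unset Strict Implicit.
Unset Printing Implicit Defensive.

Import GRing.Theory.
Local Open Scope fset_scope.
Local Open Scope ring_scope.

(** * Polynomials in the shift, and the binomial transform *)

(** This is q(S) for the shift S; the body copies the sum in [satisfies_recurrence], so that the
    final goal folds to it. *)
Definition shift_act (q : {poly int}) (a : nat -> int) (n : nat) : int :=
  \sum_(i < size q) q`_i * a (n + i)%N.

Lemma shift_act_widen (N : nat) (q : {poly int}) (a : nat -> int) (n : nat) :
  (size q <= N)%N -> shift_act q a n = \sum_(i < N) q`_i * a (n + i)%N.
Proof.
move=> leqN; rewrite /shift_act.
rewrite (big_ord_widen N (fun i => q`_i * a (n + i)%N)) // big_mkcond /=.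
apply: eq_bigr => i _; case: ltnP => // hi.
by rewrite nth_default // mul0r.
Qed.

Lemma shift_actD (q r : {poly int}) (a : nat -> int) (n : nat) :
  shift_act (q + r) a n = shift_act q a n + shift_act r a n.
Proof.
pose N := maxn (size q) (size r).
rewrite (@shift_act_widen N) ?size_polyD //.
rewrite (@shift_act_widen N q) ?leq_maxl // (@shift_act_widen N r) ?leq_maxr //.
by rewrite -big_split; apply: eq_bigr => i _; rewrite coefD mulrDl.
Qed.

Lemma shift_actN (q : {poly int}) (a : nat -> int) (n : nat) :
  shift_act (- q) a n = - shift_act q a n.
Proof.
rewrite /shift_act size_polyN -sumrN.
by apply: eq_bigr => i _; rewrite coefN mulNr.
Qed.

Lemma shift_actC (c : int) (a : nat -> int) (n : nat) :
  shift_act c%:P a n = c * a n.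
Proof.
rewrite (@shift_act_widen 1) ?size_polyC ?leq_b1 // big_ord1 /=.
by rewrite coefC addn0.
Qed.

Lemma shift_actMX (q : {poly int}) (a : nat -> int) (n : nat) :
  shift_act (q * 'X) a n = shift_act q (fun m => a m.+1) n.
Proof.
rewrite (@shift_act_widen (size q).+1).
  rewrite big_ord_recl coefMX mul0r add0r.
  by apply: eq_bigr => i _; rewrite coefMX /= /bump /= add1n addnS.
by apply: leq_trans (size_polyMleq _ _) _; rewrite size_polyX addn2.
Qed.

Lemma eq_shift_act (q : {poly int}) (a b : nat -> int) (n : nat) :
  (forall m, (n <= m)%N -> a m = b m) -> shift_act q a n = shift_act q b n.
Proof. by move=> eqab; apply: eq_bigr => i _; rewrite eqab // leq_addr. Qed.

Lemma shift_actBr (q : {poly int}) (a b : nat -> int) (n : nat) :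
  shift_act q (fun m => a m - b m) n = shift_act q a n - shift_act q b n.
Proof.
by rewrite -sumrB; apply: eq_bigr => i _; rewrite mulrBr.
Qed.

Lemma shift_act_succ (q : {poly int}) (a : nat -> int) (n : nat) :
  shift_act q (fun m => a m.+1) n = shift_act q a n.+1.
Proof. by apply: eq_bigr => i _; rewrite addSn. Qed.

(* The index shift [m.+1] keeps out the junk term [m = 0]; on generating
   functions without constant term this is the substitution of
   [x ^ 2 / (1 - x)] for [x]. *)
Definition bin_transform (a : nat -> int) (n : nat) : int :=
  \sum_(m < n.-1) a m.+1 * 'C(n - m.+2, m)%:R.

(** Pascal's rule, term by term. At [n = 0] it fails: the left side is [a 1], the right side an
    empty sum. *)
Lemma bin_transformS (a : nat -> int) (n : nat) : (0 < n)%N ->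
  bin_transform a n.+2 - bin_transform a n.+1
    = bin_transform (fun m => a m.+1) n.
Proof.
case: n => // n _; rewrite /bin_transform /=.
(* The top term of the longer sum carries 'C(0, n.+1) = 0; below, the two terms of index 0 cancel,
   which shifts the index by one. *)
rewrite big_ord_recr /= subnn bin0n mulr0 addr0 -sumrB big_ord_recl /=.
rewrite !bin0 subrr add0r; apply: eq_bigr => i _.
rewrite /bump /= add1n -mulrBr; congr (_ * _).
have -> : (n.+3 - i.+3 = (n.+1 - i.+2).+1)%N by case: i => i /= ?; lia.
have -> : (n.+2 - i.+3 = n.+1 - i.+2)%N by lia.
by rewrite binS natrD addrAC subrr add0r.
Qed.

(** Induction on the Horner form q * 'X + c. The factor 'X turns into a shift of the sequence, so
    [a] has to vary in the induction. *)
Lemma shift_act_bin_transform (q : {poly int}) (a : nat -> int) (n : nat) :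
  (0 < n)%N ->
  shift_act (q \Po ('X * ('X - 1))) (bin_transform a) n
    = bin_transform (shift_act q a) n.
Proof.
move=> n0; elim/poly_ind: q a => [|q c IH] a.
  rewrite comp_poly0 /shift_act size_poly0 big_ord0 /bin_transform.
  by rewrite big1 // => i _; rewrite big_ord0 mul0r.
rewrite comp_poly_MXaddC; move: (IH (fun m => a m.+1)) => {IH}.
set r := q \Po _ => IH; rewrite mulrBr mulr1 mulrBr !shift_actD shift_actN.
rewrite mulrA !shift_actMX shift_actC.
(* [r] now acts on T a m.+2 - T a m.+1, which for m >= n > 0 is the transform of the shifted
   sequence. *)
rewrite -shift_actBr (@eq_shift_act _ _ (bin_transform (fun m => a m.+1))).
  rewrite IH /bin_transform mulr_sumr -big_split; apply: eq_bigr => i _ /=.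
  by rewrite shift_actD shift_actMX shift_actC mulrDl mulrA.
by move=> m nm /=; rewrite bin_transformS // (leq_trans n0).
Qed.

(** * Splitting off the last block, and uniqueness of the splitting *)

Lemma maximal_schreier_neq0 (E : {fset nat}) : maximal_schreier E -> E != fset0.
Proof. by case. Qed.

Lemma maximal_kschreier0 (F : {fset nat}) : maximal_kschreier 0 F <-> F = fset0.
Proof.
split=> [[E [_ _ ->]]|->]; first by rewrite big_ord0.
by exists (fun _ => fset0); split; [case|case|rewrite big_ord0].
Qed.

Lemma in_bigfsetU (k : nat) (E : 'I_k -> {fset nat}) (x : nat) :
  reflect (exists i, x \in E i) (x \in \big[fsetU/fset0]_(i < k) E i).
Proof.
apply: (iffP idP) => [|[i xi]].
  by elim/big_ind: _ => [|A B hA hB|i _ ?]; [|rewrite inE => /orP[]|exists i].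
by rewrite (bigD1 i) //= inE xi.
Qed.

(** Comparing elements avoids the default extrema: an empty [G], the rest when [k = 0], is vacuously
    below [E]. *)
Definition fset_below (G E : {fset nat}) : Prop :=
  forall x y, x \in G -> y \in E -> (x < y)%N.

Lemma fset_max_lt_min (G E : {fset nat}) : G != fset0 -> E != fset0 ->
  (fset_max G < fset_min E)%N <-> fset_below G E.
Proof.
move=> G0 E0; have [mG ubG] := fset_maxP G0; have [mE lbE] := fset_minP E0.
split=> [lt x y /ubG xG /lbE yE|]; last exact.
exact: leq_ltn_trans xG (leq_trans lt yE).
Qed.

(** The definition orders neighbouring blocks only; since blocks are non-empty, the order chains to
    all pairs, and the union of the first k blocks lies below the last. *)
Lemma maximal_kschreierS (k : nat) (F : {fset nat}) :
  maximal_kschreier k.+1 F <->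
  exists G E, [/\ maximal_kschreier k G, maximal_schreier E,
                  fset_below G E & F = G `|` E].
Proof.
split.
  case=> E [mE ltE ->]; rewrite big_ord_recr /=.
  exists (\big[fsetU/fset0]_(i < k) E (widen_ord (leqnSn k) i)), (E ord_max).
  split=> //.
    exists (fun i => E (widen_ord (leqnSn k) i)).
    by split=> // i j ij; exact: ltE.
  (* Induction on the gap, passing through the minimum of the block just before [E j]. *)
  have lt_chain d (i j : 'I_k.+1) :
      (j = i + d.+1 :> nat)%N -> fset_below (E i) (E j).
    elim: d j => [|d IH] j ji.
      apply/fset_max_lt_min; try exact: maximal_schreier_neq0.
      by apply: ltE; rewrite ji addn1.
    have hj' : (i + d.+1 < k.+1)%N by have := ltn_ord j; lia.
    have {}IH := IH (Ordinal hj') erefl.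
    have [mj _] := fset_minP (maximal_schreier_neq0 (mE (Ordinal hj'))).
    have : fset_below (E (Ordinal hj')) (E j).
      apply/fset_max_lt_min; try exact: maximal_schreier_neq0.
      by apply: ltE => /=; lia.
    by move=> lt x y xi yj; exact: ltn_trans (IH _ _ xi mj) (lt _ _ mj yj).
  move=> x y /in_bigfsetU[i xi]; apply: (lt_chain (k - i.+1)%N) xi => /=.
  by have := ltn_ord i; lia.
case=> G [D [[E [mE ltE defG]] mD GD ->]].
(* [unlift ord_max] is [None] exactly at the last index, where [D] is appended. *)
pose E' (i : 'I_k.+1) := if unlift ord_max i is Some j then E j else D.
have E'w i : E' (widen_ord (leqnSn k) i) = E i.
  rewrite /E'; have -> : widen_ord (leqnSn k) i = lift ord_max i.
    by apply: val_inj; rewrite /= /bump leqNgt ltn_ord.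
  by rewrite liftK.
have E'max : E' ord_max = D by rewrite /E' unlift_none.
have mE' i : maximal_schreier (E' i) by rewrite /E'; case: unliftP.
exists E'; split=> //.
  move=> i j ji; have ik : (i < k)%N by have := ltn_ord j; lia.
  have -> : i = widen_ord (leqnSn k) (Ordinal ik) by apply: val_inj.
  have [jk|jk] := ltnP j k.
    have -> : j = widen_ord (leqnSn k) (Ordinal jk) by apply: val_inj.
    by rewrite !E'w; apply: ltE.
  have -> : j = ord_max by apply: val_inj => /=; have := ltn_ord j; lia.
  rewrite E'w E'max; apply/fset_max_lt_min; try exact: maximal_schreier_neq0.
  move=> x y xi yD; apply: GD yD; rewrite defG; apply/in_bigfsetU.
  by exists (Ordinal ik).
by rewrite big_ord_recr /= E'max defG; congr (_ `|` _); apply: eq_bigr.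
Qed.

(* For two sets A and B, [lower_in A B /\ lower_in B A] holds whenever both are
   initial segments of a common set. *)
Definition lower_in (A B : {fset nat}) : Prop :=
  forall x y, x \in A -> y \in B -> (y <= x)%N -> y \in A.

Lemma lower_in_fsetU (G E G' : {fset nat}) :
  fset_below G E -> G' `<=` G `|` E -> lower_in G G'.
Proof.
move=> GE /fsubsetP sub x y xG /sub; rewrite inE => /orP[//|yE].
by rewrite leqNgt (GE _ _ xG yE).
Qed.

(** The minima agree, hence so do the cardinalities. If some z of D is missing from D', no element
    of D' exceeds z, so D' is contained in D, and equal size gives equality. *)
Lemma maximal_schreier_lower_in_eq (D D' : {fset nat}) :
  maximal_schreier D -> maximal_schreier D' ->
  lower_in D D' -> lower_in D' D -> D = D'.
Proof.
move=> [D0 cD] [D'0 cD'] low low'.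
have [mD lbD] := fset_minP D0; have [mD' lbD'] := fset_minP D'0.
have eqmin : fset_min D = fset_min D'.
  apply/eqP; rewrite eqn_leq; case: (leqP (fset_min D) (fset_min D')) => h.
    by rewrite lbD' // (low' _ _ mD' mD h).
  by have := lbD _ (low _ _ mD mD' (ltnW h)); rewrite leqNgt h.
have card : #|` D| = #|` D'| by rewrite cD cD'.
have [/fsubset_cardP|/fsubsetPn[z zD zD']] := boolP (D `<=` D').
  by move=> /(_ card) /fsetP.
suff /fsubset_cardP : D' `<=` D by move=> /(_ (esym card)) /fsetP.
apply/fsubsetP => y yD'; apply: (low z) => //; rewrite leqNgt; apply/negP => zy.
by move: zD'; rewrite (low' _ _ yD' zD (ltnW zy)).
Qed.

(** Both relations restrict to the rests, equal by induction, and then to the last blocks. *)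
Lemma maximal_kschreier_lower_in_eq (k : nat) (G G' : {fset nat}) :
  maximal_kschreier k G -> maximal_kschreier k G' ->
  lower_in G G' -> lower_in G' G -> G = G'.
Proof.
elim: k G G' => [|k IH] G G'.
  by move=> /maximal_kschreier0-> /maximal_kschreier0->.
move=> /maximal_kschreierS[H [D [kH mD HD ->]]].
move=> /maximal_kschreierS[H' [D' [kH' mD' HD' ->]]].
have lowH A B A' B' : fset_below A B -> lower_in (A `|` B) (A' `|` B') ->
    lower_in A A'.
  move=> AB low x y xA yA' yx; have := low x y.
  rewrite !inE xA yA' => /(_ isT isT yx).
  by case/orP => // yB; have := AB _ _ xA yB; rewrite ltnNge yx.
move=> low low'; have eqH : H = H'.
  by apply: IH => //; [exact: lowH low|exact: lowH low'].
move: HD' low low'; rewrite -eqH => HD' low low'.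
have lowD B B' : fset_below H B' -> lower_in (H `|` B) (H `|` B') ->
    lower_in B B'.
  move=> HB' lo x y xB yB' yx; have := lo x y; rewrite !inE xB yB' !orbT.
  by move=> /(_ isT isT yx) /orP[yH|//]; have := HB' _ _ yH yB'; rewrite ltnn.
by congr (_ `|` _); apply: maximal_schreier_lower_in_eq => //; exact: lowD.
Qed.

(** [G] and [G'] are initial segments of the same union, hence equal; [E] and [E'] are what
    remains. *)
Lemma maximal_kschreierS_inj (k : nat) (G E G' E' : {fset nat}) :
  maximal_kschreier k G -> maximal_kschreier k G' ->
  fset_below G E -> fset_below G' E' ->
  G `|` E = G' `|` E' -> G = G' /\ E = E'.
Proof.
move=> kG kG' GE GE' eqU.
have eqG : G = G'.
  apply: (maximal_kschreier_lower_in_eq kG kG').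
    by apply: (lower_in_fsetU GE); rewrite eqU fsubsetUl.
  by apply: (lower_in_fsetU GE'); rewrite -eqU fsubsetUl.
split=> //; move: GE' eqU; rewrite -eqG => GE' /fsetP eqU; apply/fsetP => x.
have := eqU x; rewrite !inE; have [xG|//] := boolP (x \in G).
move=> _; apply/idP/idP => [/(GE _ _ xG)|/(GE' _ _ xG)]; by rewrite ltnn.
Qed.

(** * Counting maximal k-Schreier sets *)

(** Transport of [card_draws] from the finite type of elements of [A]. *)
Lemma card_fset_draws (K : choiceType) (A : {fset K}) (s : nat) :
  #|` [fset F in fpowerset A | #|` F| == s]| = 'C(#|` A|, s).
Proof.
pose val_set (Y : {set A}) : {fset K} := [fsetval y in Y].
have val_set_inj : injective val_set.
  move=> Y Z /fsetP eqYZ; apply/setP => y.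
  by have := eqYZ (val y); rewrite !inE.
have card_val_set Y : #|` val_set Y| = #|Y|.
  by rewrite card_imfset -?cardE //; exact: val_inj.
rewrite [#|` A|]cardfE -card_draws.
have -> : #|[set Y : {set A} | #|Y| == s]|
    = #|` [fset val_set Y | Y in [set Y : {set A} | #|Y| == s]]|.
  by rewrite card_imfset -?cardE.
congr #|` _|; apply/fsetP => F; apply/idP/imfsetP => /=.
  rewrite !inE fpowersetE => /andP[FA cF]; exists (fsub A F).
    by rewrite inE -card_val_set /val_set fsubK.
  by rewrite /val_set fsubK.
case=> Y; rewrite inE => cY ->; rewrite !inE fpowersetE card_val_set cY andbT.
by apply/fsubsetP => y /in_fset_valP[].
Qed.

(** For [k = 0] this contains [fset0] alone, whatever [n]: the constant count 1 starts the
    induction. *)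
Definition ksets (k n : nat) : {fset {fset nat}} :=
  [fset F in fpowerset [fset x in iota 0 n] | `[< maximal_kschreier k F >]].

Lemma in_ksets (k n : nat) (F : {fset nat}) :
  F \in ksets k n <-> maximal_kschreier k F /\ forall x, x \in F -> (x < n)%N.
Proof.
rewrite !inE /= fpowersetE; split.
  case/andP => /fsubsetP sub /asboolP kF; split=> // x /sub.
  by rewrite in_fset /= mem_iota.
case=> kF sub; apply/andP; split; last exact/asboolP.
by apply/fsubsetP => x /sub; rewrite in_fset /= mem_iota.
Qed.

(** Split by whether the maximum is n. Since [fset_max fset0] is 0, the case [k = n = 0] would count
    the empty set twice. *)
Lemma card_ksetsS_r0 (k n : nat) : (0 < n)%N ->
  #|` ksets k n.+1| = (#|` ksets k n| + r0 k n)%N.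
Proof.
move=> n0; rewrite -(cardfsID (r0_sets k n) (ksets k n.+1)) addnC /r0.
have fmax F : F != fset0 -> fset_max F \in F by case/fset_maxP.
congr (_ + _)%N; congr #|` _|; apply/fsetP => F; apply/idP/idP.
- rewrite in_fsetD => /andP[nr /in_ksets[kF lt]]; apply/in_ksets.
  split=> // x xF; have F0 : F != fset0 by apply/fset0Pn; exists x.
  have [mF ubF] := fset_maxP F0.
  apply: leq_ltn_trans (ubF _ xF) _; rewrite ltn_neqAle -ltnS lt // andbT.
  by apply: contra nr => /eqP mn; apply/in_r0_sets.
- case/in_ksets => kF lt; rewrite in_fsetD; apply/andP; split.
    apply/negP => /in_r0_sets[_]; have [->|F0] := eqVneq F fset0.
      by rewrite /fset_max big_nil => n0'; rewrite -n0' in n0.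
    by move=> mn; have := lt _ (fmax _ F0); rewrite mn ltnn.
  by apply/in_ksets; split=> // x /lt; apply: leqW.
- by rewrite inE => /andP[].
- move=> rF; rewrite inE rF andbT; case/in_r0_sets: rF => kF mn.
  apply/in_ksets; split=> // x xF.
  have F0 : F != fset0 by apply/fset0Pn; exists x.
  by rewrite ltnS -mn; have [_] := fset_maxP F0; apply.
Qed.

Lemma card_ksets0 (n : nat) : #|` ksets 0 n| = 1%N.
Proof.
rewrite -(cardfs1 (fset0 : {fset nat})); congr #|` _|; apply/fsetP => F.
rewrite in_fset1; apply/idP/eqP => [/in_ksets[/maximal_kschreier0]//|->].
by apply/in_ksets; split; first exact/maximal_kschreier0.
Qed.

Definition last_blocks (m n : nat) : {fset {fset nat}} :=
  [fset E in fpowerset [fset x in iota 0 n]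
     | `[< maximal_schreier E >] && (fset_min E == m.+1)].

Lemma in_last_blocks (m n : nat) (E : {fset nat}) :
  E \in last_blocks m n <->
  [/\ maximal_schreier E, fset_min E = m.+1 & forall x, x \in E -> (x < n)%N].
Proof.
rewrite !inE /= fpowersetE; split.
  case/and3P => /fsubsetP sub /asboolP kF /eqP mF; split=> // x /sub.
  by rewrite in_fset /= mem_iota.
case=> kF mF sub; apply/and3P; split; [|exact/asboolP|exact/eqP].
by apply/fsubsetP => x /sub; rewrite in_fset /= mem_iota.
Qed.

Lemma fset_min_eq (E : {fset nat}) (m : nat) :
  m \in E -> (forall x, x \in E -> (m <= x)%N) -> fset_min E = m.
Proof.
move=> mE lbm; have E0 : E != fset0 by apply/fset0Pn; exists m.
have [minE lbE] := fset_minP E0.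
by apply/eqP; rewrite eqn_leq lbE // lbm.
Qed.

(** Minimum m + 1 forces size m + 1; the other m elements are free among the n - m - 2 numbers
    strictly between m + 1 and n. *)
Lemma card_last_blocks (m n : nat) : (m.+1 < n)%N ->
  #|` last_blocks m n| = 'C(n - m.+2, m).
Proof.
move=> mn; pose A := [fset x in iota m.+2 (n - m.+2)].
have inA x : (x \in A) = (m.+1 < x < n)%N.
  by rewrite in_fset /= mem_iota subnKC.
have cA : #|` A| = (n - m.+2)%N.
  by rewrite card_fseq undup_id ?iota_uniq // size_iota.
rewrite -cA -card_fset_draws.
set S := [fset F in _ | _].
have inS F : (F \in S) = (F `<=` A) && (#|` F| == m) by rewrite !inE fpowersetE.
have mNF F : F `<=` A -> m.+1 \notin F.
  by move=> /fsubsetP sub; apply/negP => /sub; rewrite inA ltnn.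
have <- : #|` [fset m.+1 |` F | F in S]| = #|` S|.
  apply: card_in_imfset => F F' /=; rewrite !inS.
  move=> /andP[/mNF h _] /andP[/mNF h' _].
  move=> eqF; rewrite -(mem_fsetD1 h) -(mem_fsetD1 h') -(fsetU1K h) eqF.
  by rewrite fsetU1K // !mem_fsetD1.
congr #|` _|; apply/fsetP => E; apply/idP/imfsetP => /=.
  case/in_last_blocks => [[E0 cE] mE lt]; have [minE lbE] := fset_minP E0.
  rewrite mE in cE minE lbE; exists (E `\ m.+1); last by rewrite fsetD1K.
  rewrite inS; apply/andP; split.
    apply/fsubsetP => x; rewrite in_fsetD1 inA => /andP[xm xE].
    by rewrite lt // andbT ltn_neqAle eq_sym xm lbE.
  by move: cE; rewrite (cardfsD1 m.+1) minE add1n => -[->].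
case=> F; rewrite inS => /andP[subF /eqP cF] ->.
have min_m : fset_min (m.+1 |` F) = m.+1.
  apply: fset_min_eq => [|x]; rewrite !inE ?eqxx // => /orP[/eqP->//|].
  by move=> /(fsubsetP subF); rewrite inA => /andP[/ltnW].
apply/in_last_blocks; split=> //.
  split; first by apply/fset0Pn; exists m.+1; rewrite !inE eqxx.
  by rewrite min_m cardfsU1 (mNF _ subF) cF.
move=> x; rewrite !inE => /orP[/eqP->//|/(fsubsetP subF)].
by rewrite inA => /andP[].
Qed.

Lemma cardfs_fibers (K : choiceType) (A : {fset K}) (f : K -> nat) (N : nat) :
  (forall x, x \in A -> (f x < N)%N) ->
  #|` A| = (\sum_(m < N) #|` [fset x in A | f x == m]|)%N.
Proof.
move=> fN.
have card1 (B : {fset K}) : #|` B| = (\sum_(x <- B) 1)%N by rewrite sum1_size.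
rewrite card1 (eq_big_seq (fun x => \sum_(m < N) (f x == m))%N).
  rewrite exchange_big; apply: eq_bigr => m _.
  rewrite card1 big_fset [in RHS]big_mkcond; apply: eq_bigr => x _.
  by case: eqP.
move=> x xA; rewrite (bigD1 (Ordinal (fN _ xA))) //= eqxx big1 // => i.
by rewrite eq_sym -val_eqE /= => /negPf->.
Qed.

Lemma card_fsetX (K K' : choiceType) (A : {fset K}) (B : {fset K'}) :
  #|` A `*` B| = (#|` A| * #|` B|)%N.
Proof.
rewrite (perm_size (enum_imfset2 _ _)) /=.
  by rewrite size_allpairs.
by move=> [x y] [x' y'] _ _ /= [-> ->].
Qed.

(** Count pairs (rest, last block) instead of unions, sorted by the minimum of the last block. *)
Lemma card_ksetsS (k n : nat) :
  #|` ksets k.+1 n| = (\sum_(m < n.-1) #|` ksets k m.+1| * 'C(n - m.+2, m))%N.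
Proof.
pose P := fpowerset [fset x in iota 0 n].
pose D := [fset p : {fset nat} * {fset nat} in P `*` P |
  `[< [/\ maximal_kschreier k p.1, maximal_schreier p.2
        & fset_below p.1 p.2] >]].
have inP F : F \in P <-> forall x, x \in F -> (x < n)%N.
  rewrite fpowersetE; split=> [/fsubsetP sub x /sub|lt].
    by rewrite in_fset /= mem_iota.
  by apply/fsubsetP => x /lt; rewrite in_fset /= mem_iota.
have inD p : p \in D <-> [/\ p.1 \in P /\ p.2 \in P, maximal_kschreier k p.1,
    maximal_schreier p.2 & fset_below p.1 p.2].
  rewrite inE /= inE -[p \in _]/(p \in P `*` P) in_fsetM; split.
    by case/andP => /andP[? ?] /asboolP[].
  by case=> [[-> ->] ? ? ?]; apply/asboolP.
have -> : ksets k.+1 n = [fset p.1 `|` p.2 | p in D].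
  apply/fsetP => F; apply/idP/imfsetP => /=.
    case/in_ksets => /maximal_kschreierS[G [E [kG mE GE ->]]] lt.
    exists (G, E) => //; apply/inD; split=> //=.
    by split; apply/inP => x xx; apply: lt; rewrite inE xx ?orbT.
  case=> p /inD[[/inP lt1 /inP lt2] kp mp bp] ->; apply/in_ksets; split.
    by apply/maximal_kschreierS; exists p.1, p.2.
  by move=> x; rewrite inE => /orP[/lt1|/lt2].
rewrite card_in_imfset; last first.
  move=> [G E] [G' E'] /inD[_ /= kG _ GE] /inD[_ /= kG' _ GE'] eqU.
  by have [-> ->] := maximal_kschreierS_inj kG kG' GE GE' eqU.
(* The minimum is the size of a non-empty set, so taking its predecessor below loses nothing. *)
have min_gt0 p : p \in D -> (0 < fset_min p.2 < n)%N.
  case/inD => [[_ /inP lt] _ [E0 cE] _]; have [minE _] := fset_minP E0.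
  by rewrite lt // -cE cardfs_gt0 E0.
rewrite (@cardfs_fibers _ _ (fun p => (fset_min p.2).-1) n.-1); last first.
  by move=> p /min_gt0; lia.
apply: eq_bigr => m _.
(* Once min E = m + 1 is fixed, lying below E means lying below m + 1, so the fibre is a product. *)
rewrite -card_last_blocks; last by have := ltn_ord m; lia.
rewrite -card_fsetX; congr #|` _|; apply/fsetP => p; rewrite in_fsetM.
apply/idP/andP.
  rewrite inE /= => /andP[pD /eqP minp]; have := min_gt0 _ pD.
  case/inD: pD => [[/inP lt1 /inP lt2] kp mp bp] minE.
  have {}minp : fset_min p.2 = m.+1.
    by case/andP: minE => min0 _; rewrite -(prednK min0) minp.
  split; last exact/in_last_blocks.
  apply/in_ksets; split=> // x xp; rewrite -minp; apply: bp xp _.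
  by case: mp => /fset_minP[].
case=> /in_ksets[kp lt1] /in_last_blocks[mp minp lt2].
have [min2 lb2] := fset_minP (maximal_schreier_neq0 mp).
have pD : p \in D.
  apply/inD; split=> //.
    split; apply/inP => // x /lt1 xm; apply: leq_trans xm _.
    by rewrite -minp ltnW // lt2.
  by move=> x y /lt1 xm /lb2; rewrite minp; apply: leq_trans.
rewrite inE /=; apply/andP; split; first exact: pD.
apply/eqP; exact: (congr1 predn minp).
Qed.

(** * The recurrence *)

Lemma shift_act_card_ksets (k n : nat) : (0 < n)%N ->
  shift_act (p_ k) (fun m => (#|` ksets k m|)%:Z) n = 0.
Proof.
elim: k n => [|k IH] n n0.
  have -> : p_ 0 = 1%:P * 'X + (-1)%:P by rewrite mul1r polyCN.
  by rewrite shift_actD shift_actMX !shift_actC !card_ksets0 mulN1r mul1r subrr.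
rewrite (@eq_shift_act _ _ (bin_transform (fun m => (#|` ksets k m|)%:Z)));
  last first.
  move=> m _; rewrite card_ksetsS /bin_transform -natz natr_sum.
  by apply: eq_bigr => i _; rewrite natrM !natz.
(* The transform reads its argument at indices [i.+1] only, where the induction hypothesis
   applies. *)
rewrite shift_act_bin_transform // /bin_transform big1 // => i _.
by rewrite IH // mul0r.
Qed.

(** Degrees multiply under composition, so being non-constant, unlike being non-zero, passes
    directly through the induction. *)
Lemma p_neq0 (k : nat) : p_ k != 0.
Proof.
suff : (1 < size (p_ k))%N by rewrite -size_poly_gt0; apply: ltnW.
elim: k => [|k IH] /=; first by rewrite -polyC1 size_XsubC.
have sQ : size ('X * ('X - 1) : {poly int}) = 3%N.
  by rewrite mulrC size_mulX -?polyC1 ?polyXsubC_eq0 ?size_XsubC.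
by move: IH; rewrite -!ltn_predRL size_comp_poly sQ muln_gt0 => ->.
Qed.

Theorem corollary2 (k : nat) (hk : (0 < k)%N) :
  satisfies_recurrence (p_ k) (fun n : nat => Posz (r0 k n)).
Proof.
split; first exact: p_neq0.
move=> n n0; rewrite -/(shift_act (p_ k) (fun n : nat => Posz (r0 k n)) n).
pose c m := (#|` ksets k m|)%:Z.
(* At indices m >= n > 0, [r0 k m] is the forward difference of [c], and p_k(S) kills both [c] and
   its shift. *)
rewrite (@eq_shift_act _ _ (fun m => c m.+1 - c m)).
  by rewrite shift_actBr shift_act_succ !shift_act_card_ksets // subrr.
move=> m nm; rewrite /c card_ksetsS_r0 ?(leq_trans n0) //.
by rewrite PoszD addrAC subrr add0r.
Qed.
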